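(* Let $p(\lambda)=1+a_1\lambda+a_2\lambda^2+\dots+a_d\lambda^d\in\mathbb{C}[\lambda]$ be a polynomial with $p(0)=1$ which is stable with respect to the open upper half-plane $H_0$, and let $A\in\mathbb{C}^{n,n}$ be a complex square matrix. Then $$\|p(A)\|\leq\exp\Bigl(|a_1|\,\|A\|+\frac12\bigl(|a_1|^2-2\operatorname{Re}a_2\bigr)\|A\|^2\Bigr).$$
   Context: $H_0=\{\lambda\in\mathbb{C}:\operatorname{Im}\lambda>0\}$. A scalar polynomial is stable with respect to $H_0$ if it has no roots in $H_0$. The norm $\|\cdot\|$ is the operator two-norm (spectral norm) of a matrix. Coefficients $a_j$ with $j$ larger than the degree of $p$ are understood to be $0$. *)

(* Defs.v *)
From mathcomp Require Import all_boot all_order all_algebra.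
From mathcomp Require Import complex.
From mathcomp Require Import boolp classical_sets reals topology normedtype sequences exp.
Set Implicit Arguments.
Unset Strict Implicit.
Unset Printing Implicit Defensive.
Import Order.TTheory GRing.Theory Num.Theory.
Local Open Scope ring_scope.
Local Open Scope complex_scope.
Local Open Scope classical_set_scope.

Definition upper_half_plane (R : realType) : set R[i] := [set z | 0 < complex.Im z].

Definition stable (R : realType) (D : set R[i]) (p : {poly R[i]}) : Prop :=
  forall z, D z -> ~~ root p z.

(* [Normc.normc] is the modulus with values in [R]; the generic norm [`|z|] on
   [R[i]] takes its values in [R[i]]. *)
Definition norm2 (R : realType) (n : nat) (x : 'cV[R[i]]_n) : R :=
  Num.sqrt (\sum_(i < n) Normc.normc (x i 0) ^+ 2).

(* The supremum is over the closed unit ball, not the unit sphere, so that the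
   set is nonempty even for [n = 0]; [sup] is a genuine supremum here since
   the set is bounded. *)
Definition opnorm2 (R : realType) (m n : nat) (A : 'M[R[i]]_(m, n)) : R :=
  sup [set norm2 (A *m x) | x in [set x : 'cV[R[i]]_n | norm2 x <= 1]].

(* Main.v *)
(** With [w_j] the negated inverses of the roots, [p = \prod_j (1 + w_j X)],
    where [Im w_j <= 0] by stability.  From
      [|1 + w z|^2 = 1 + 2 Re (w z) + |w z|^2 <= exp (2 Re (w z) + |w z|^2)]
    and [\sum_j |w_j|^2 <= |a_1|^2 - 2 Re a_2] (the difference is
    [4 \sum_(j < k) Im w_j * Im w_k]), the inequality holds for scalars.  It
    passes to matrices by von Neumann's inequality, which is obtained here from
    positivity of Fejer kernels: for a contraction [S], with
    [G_i = \sum_(k <= i) S^k], one has [G_(i+1) = 1 + S G_i], so the quadratic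
    form of [\sum_(i < N) (G_i + G_i^* - 1)] at [x] is the sum of the
    [|G_i x|^2 - |S G_(i-1) x|^2], which is nonnegative by telescoping.
    Averaging these kernels for [S = conj w T] against [p(w)] over roots of
    unity [w] gives the Cesaro means of [p(T)], and [N] tends to infinity. *)

Require Import Defs.
From mathcomp Require Import all_boot all_order all_algebra cyclic separable cyclotomic.
From mathcomp Require Import complex zify ring lra.
From mathcomp Require Import boolp classical_sets reals topology normedtype sequences exp.
Set Implicit Arguments.
Unset Strict Implicit.
Unset Printing Implicit Defensive.
Import Order.TTheory GRing.Theory Num.Theory.
Local Open Scope ring_scope.

(** * Positive sesquilinear forms and Fejer kernels of contractions *)

Section HermitianForms.
Local Open Scope sesquilinear_scope.
Variables (C : numClosedFieldType) (n : nat).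
Implicit Types (x y : 'cV[C]_n.+1) (K S T : 'M[C]_n.+1) (c : C).

Definition sesqui K y x : C := (y ^t* *m K *m x) 0 0.
Definition sqnorm x : C := (x ^t* *m x) 0 0.

Lemma adjmx_mul m k l (A : 'M[C]_(m, k)) (B : 'M[C]_(k, l)) :
  (A *m B) ^t* = B ^t* *m A ^t*.
Proof. by rewrite trmx_mul map_mxM. Qed.

Lemma adjmxX K k : (K ^+ k) ^t* = K ^t* ^+ k.
Proof.
elim: k => [|k IH]; first by rewrite !expr0 trmx1 map_mx1.
by rewrite exprS exprSr -IH; exact: adjmx_mul.
Qed.

Lemma adjmxZ m k c (A : 'M[C]_(m, k)) : (c *: A) ^t* = c^* *: A ^t*.
Proof. by rewrite linearZ map_mxZ. Qed.

Lemma adjmxD m k (A B : 'M[C]_(m, k)) : (A + B) ^t* = A ^t* + B ^t*.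
Proof. by rewrite linearD map_mxD. Qed.

Lemma adjmx_sum m k (I : finType) (F : I -> 'M[C]_(m, k)) :
  (\sum_i F i) ^t* = \sum_i (F i) ^t*.
Proof. by rewrite !linear_sum map_mx_sum. Qed.

Lemma sqnormE x : sqnorm x = \sum_i `|x i 0| ^+ 2.
Proof.
rewrite /sqnorm mxE; apply: eq_bigr => i _.
by rewrite !mxE normCK mulrC.
Qed.

Lemma sqnorm_ge0 x : 0 <= sqnorm x.
Proof. by rewrite sqnormE sumr_ge0 // => i _; rewrite exprn_ge0. Qed.

Lemma sqnormZ c x : sqnorm (c *: x) = `|c| ^+ 2 * sqnorm x.
Proof.
rewrite !sqnormE mulr_sumr; apply: eq_bigr => i _.
by rewrite mxE normrM exprMn.
Qed.

Lemma sesquiDl K y y' x : sesqui K (y + y') x = sesqui K y x + sesqui K y' x.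
Proof. by rewrite /sesqui adjmxD !mulmxDl mxE. Qed.

Lemma sesquiDr K y x x' : sesqui K y (x + x') = sesqui K y x + sesqui K y x'.
Proof. by rewrite /sesqui !mulmxDr mxE. Qed.

Lemma sesquiZl K c y x : sesqui K (c *: y) x = c^* * sesqui K y x.
Proof. by rewrite /sesqui adjmxZ -!scalemxAl mxE. Qed.

Lemma sesquiZr K c y x : sesqui K y (c *: x) = c * sesqui K y x.
Proof. by rewrite /sesqui -!scalemxAr mxE. Qed.

Lemma sesqui_sum (I : finType) (F : I -> 'M[C]_n.+1) y x :
  sesqui (\sum_i F i) y x = \sum_i sesqui (F i) y x.
Proof. by rewrite /sesqui mulmx_sumr mulmx_suml summxE. Qed.

Lemma sesquiZ c K y x : sesqui (c *: K) y x = c * sesqui K y x.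
Proof. by rewrite /sesqui -scalemxAr -scalemxAl mxE. Qed.

Lemma sesquiD K L y x : sesqui (K + L) y x = sesqui K y x + sesqui L y x.
Proof. by rewrite /sesqui mulmxDr mulmxDl mxE. Qed.

Lemma sesqui1 x : sesqui 1 x x = sqnorm x.
Proof. by rewrite /sesqui mulmx1. Qed.

Lemma sesqui_mulr y K x : sesqui K y x = sesqui 1 y (K *m x).
Proof. by rewrite /sesqui mulmx1 mulmxA. Qed.

(** In [C], [0 <= c] forces [c] to be real, so this condition contains the Hermitian symmetry of the
    form. *)
Definition psd K := forall x, 0 <= sesqui K x x.

(** Cauchy-Schwarz in arithmetic-mean form, which is linear in [K] on the right and so can be summed
    over kernels. It comes from positivity at [x + c *: y] for a unimodular [c]. *)
Lemma psd_le_mean K x y : psd K ->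
  2 * `|sesqui K y x| <= sesqui K x x + sesqui K y y.
Proof.
move=> K0.
have key c : 0 <= sesqui K x x + c^* * sesqui K y x + c * sesqui K x y
    + `|c| ^+ 2 * sesqui K y y.
  have := K0 (x + c *: y); rewrite !(sesquiDl, sesquiDr, sesquiZl, sesquiZr).
  by rewrite normCK; congr (0 <= _); ring.
set b := sesqui K y x; set b' := sesqui K x y.
have X0 := K0 x; have Y0 := K0 y.
have rl c : c^* * b + c * b' \is Num.real.
  have -> : c^* * b + c * b' = (sesqui K x x + c^* * b + c * b'
     + `|c| ^+ 2 * sesqui K y y) - (sesqui K x x + `|c| ^+ 2 * sesqui K y y).
    by ring.
  rewrite rpredB ?ger0_real ?key //.
  by rewrite addr_ge0 // mulr_ge0 // exprn_ge0.
(* The cross terms are real for every [c]; the cases [c = 1] and [c = 'i] give the symmetry. *)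
have bb : b' = b^*.
  have /CrealP := rl 1; have /CrealP := rl 'i.
  rewrite !(rmorphD, rmorphM, rmorph1, conjCi, conjCK) /= rmorphN /= conjCi.
  move=> h1 h2.
  have h3 : b^* + b'^* = b + b' by move: h2; rewrite !mul1r.
  have h4 : b^* - b'^* = b' - b.
    apply: (mulfI (neq0Ci C)); rewrite !mulrBr.
    by move: h1; rewrite !mulNr opprK [- _ + _]addrC => ->; rewrite addrC.
  have h5 : 2 * b^* = 2 * b'.
    have -> : 2 * b^* = (b^* + b'^*) + (b^* - b'^*) by ring.
    by rewrite h3 h4; ring.
  have two0 : (2 : C) != 0 by rewrite pnatr_eq0.
  by rewrite (mulfI two0 h5).
have [b0|b0] := eqVneq b 0.
  by rewrite -/b b0 normr0 mulr0 addr_ge0.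
(* This phase turns both cross terms into [- |b|]. *)
have := key (- (b / `|b|)); rewrite -/b -/b' bb normrN.
have nb : `|b| != 0 by rewrite normr_eq0.
rewrite normrM normfV normr_id divff // expr1n mul1r.
rewrite rmorphN rmorphM fmorphV /= (CrealP (normr_real b)).
have -> : - (b^* / `|b|) * b = - `|b|.
  by rewrite mulNr mulrAC (mulrC _ b) -normCK expr2 mulfK.
have -> : - (b / `|b|) * b^* = - `|b|.
  by rewrite mulNr mulrAC -normCK expr2 mulfK.
by move=> h; rewrite -subr_ge0; move: h; congr (0 <= _); ring.
Qed.

Definition geomx S i : 'M[C]_n.+1 := \sum_(k < i.+1) S ^+ k.

(* [N] times the [N]-th Fejer mean of the operator Poisson kernel. *)
Definition fejermx S N : 'M[C]_n.+1 :=
  \sum_(i < N) (geomx S i + (geomx S i) ^t* - 1).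

Lemma geomxS S i : geomx S i.+1 = 1 + S * geomx S i.
Proof.
rewrite /geomx big_ord_recl expr0; congr (_ + _).
by rewrite mulr_sumr; apply: eq_bigr => k _; rewrite /= exprS.
Qed.

Lemma sesqui_geomx G x :
  sesqui (G + G ^t* - 1) x x = sqnorm (G *m x) - sqnorm (G *m x - x).
Proof.
rewrite /sesqui /sqnorm -[- x]scaleN1r -[- (1 : 'M_n.+1)]scaleN1r.
rewrite adjmxD adjmxZ !adjmx_mul rmorphN1.
rewrite !(mulmxDr, mulmxDl) -?(scalemxAl, scalemxAr) -?(scalemxAl, scalemxAr).
rewrite !mulmxA mulmx1 !mxE; ring.
Qed.

Lemma psd_fejermx S N :
  (forall x, sqnorm (S *m x) <= sqnorm x) -> psd (fejermx S N).
Proof.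
move=> S1 x; case: N => [|N].
  by rewrite /fejermx big_ord0 /sesqui mulmx0 mul0mx mxE.
(* Nonnegativity alone does not pass through the induction. The stronger lower bound by the last
   squared norm does, as it absorbs the next negative term. *)
apply: le_trans (sqnorm_ge0 (geomx S N *m x)) _.
elim: N => [|N IH].
  rewrite /fejermx big_ord1 sesqui_geomx.
  have -> : geomx S 0 = 1 by rewrite /geomx big_ord1 expr0.
  by rewrite mul1mx subrr -[0](scale0r x) sqnormZ normr0 expr0n mul0r subr0.
rewrite /fejermx big_ord_recr /= -/(fejermx S N.+1) sesquiD sesqui_geomx.
rewrite addrCA lerDl subr_ge0.
have -> : geomx S N.+1 *m x - x = S *m (geomx S N *m x).
  by rewrite geomxS mulmxDl mul1mx addrC addKr -mulmxA.
exact: le_trans (S1 _) IH.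
Qed.

End HermitianForms.

(** * Orthogonality relations for roots of unity *)

Section RootsOfUnity.
Variable C : numClosedFieldType.

(** In characteristic zero ['X^n - 1] is separable, so it has [n] distinct roots, and a group of [n]
    such roots is cyclic. *)
Lemma prim_root_exists n : (0 < n)%N -> exists z : C, n.-primitive_root z.
Proof.
move=> n0; have [r] := closed_field_poly_normal ('X^n - 1 : {poly C}).
have /monicP -> := monicXnsubC (1 : C) n0; rewrite scale1r => XnE.
have szr : size r = n.
  by apply: succn_inj; rewrite -(size_prod_XsubC r id) -XnE size_XnsubC.
have ur : uniq r.
  by rewrite -separable_prod_XsubC -XnE separable_Xn_sub_1 // pnatr_eq0 -lt0n.
have rootr : all n.-unity_root r.
  by apply/allP => z zr; rewrite /root_of_unity XnE root_prod_XsubC.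
have /hasP[z _ zn] : has n.-primitive_root r by rewrite has_prim_root // szr.
by exists z.
Qed.

Lemma sum_prim_root n (z : C) m : n.-primitive_root z ->
  \sum_(j < n) (z ^+ j) ^+ m = if (n %| m)%N then n%:R else 0.
Proof.
move=> zn; under eq_bigr do rewrite -exprM mulnC exprM.
have [/dvdnP[q ->]|ndvd] := ifPn.
  under eq_bigr do rewrite mulnC exprM (prim_expr_order zn) !expr1n.
  by rewrite sumr_const card_ord.
have zm1 : z ^+ m - 1 != 0 by rewrite subr_eq0 -(prim_order_dvd zn).
apply: (mulfI zm1); rewrite -subrX1 mulr0 -exprM mulnC exprM.
by rewrite (prim_expr_order zn) expr1n subrr.
Qed.

Lemma norm_prim_root n (z : C) : n.-primitive_root z -> `|z| = 1.
Proof.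
move=> zn; have n0 := prim_order_gt0 zn; apply/eqP.
by rewrite -(@pexpr_eq1 _ _ n) // -normrX (prim_expr_order zn) normr1.
Qed.

(** The inverse [k]-th power is an [(n - k)]-th power, and [m + (n - k)] lies strictly between [0]
    and [2 * n], so [n] divides it only if it equals [n]. *)
Lemma sum_prim_rootV n (z : C) m k : n.-primitive_root z ->
  (m < n)%N -> (k < n)%N ->
  \sum_(j < n) (z ^+ j) ^+ m * ((z ^+ j)^-1) ^+ k = if m == k then n%:R else 0.
Proof.
move=> zn mn kn.
rewrite (eq_bigr (fun j : 'I_n => (z ^+ j) ^+ (m + (n - k)))); last first.
  move=> j _; rewrite exprD; congr (_ * _).
  have zj0 : z ^+ j != 0.
    by rewrite expf_neq0 // (prim_root_eq0 zn) -lt0n (leq_ltn_trans _ kn).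
  apply: (mulfI (expf_neq0 k zj0)); rewrite -exprMn divff // expr1n -exprD.
  by rewrite subnKC ?(ltnW kn) // exprAC (prim_expr_order zn) expr1n.
rewrite (sum_prim_root _ zn); congr (if _ then _ else _).
rewrite -(addn0 (m + _)%N).
apply/idP/eqP => [|->]; last by rewrite addn0 subnKC // ltnW.
rewrite addn0 -(dvdn_addl _ (dvdnn n)) => /dvdnP[q].
rewrite -addnA => eq.
have {}eq : (m + n + n = q * n + k)%N by rewrite -eq; lia.
have : (q = 2)%N by nia.
lia.
Qed.

End RootsOfUnity.

(** * Averaging Fejer kernels over roots of unity *)

Section VonNeumann.
Local Open Scope sesquilinear_scope.
Variables (C : numClosedFieldType) (n : nat).
Implicit Types (x y : 'cV[C]_n.+1) (T : 'M[C]_n.+1).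

(** Extraction of a Fourier coefficient. The part in powers of [T] gives [T ^+ m] once for each
    [i >= m]; the adjoint part carries nonnegative powers of the root, so it survives only for
    [m = 0], where it cancels against the [- 1]. *)
Lemma sum_prim_root_fejermx h (z : C) T m N :
  h.-primitive_root z -> (m + N <= h)%N -> (0 < N)%N ->
  \sum_(j < h) (z ^+ j) ^+ m *: fejermx ((z ^+ j)^-1 *: T) N =
  h%:R *: \sum_(i < N) (if (m <= i)%N then T ^+ m else 0).
Proof.
move=> zh mNh N0; rewrite /fejermx scaler_sumr.
under eq_bigr do rewrite scaler_sumr.
rewrite exchange_big; apply: eq_bigr => i _ /=.
have iN := ltn_ord i.
have zjV j : ((z ^+ j)^-1)^* = z ^+ j.
  by rewrite invC_norm normrX (norm_prim_root zh) expr1n expr1n invr1 mul1r conjCK.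
under eq_bigr do rewrite !scalerDr.
rewrite !big_split /=.
have -> : \sum_(j < h) (z ^+ j) ^+ m *: geomx ((z ^+ j)^-1 *: T) i =
    h%:R *: (if (m <= i)%N then T ^+ m else 0).
  under eq_bigr do rewrite /geomx scaler_sumr.
  rewrite exchange_big /=.
  transitivity (\sum_(k < i.+1) (if m == k then h%:R else 0) *: T ^+ k).
    apply: eq_bigr => k _; have := ltn_ord k => ki.
    rewrite -(sum_prim_rootV zh) ?scaler_suml; [|lia|lia].
    by apply: eq_bigr => j _; rewrite exprZn scalerA.
  have [mi|mi] := ifPn.
    have mi' : (m < i.+1)%N by [].
    rewrite (bigD1 (Ordinal mi')) //= eqxx big1 ?addr0 // => k.
    by rewrite -val_eqE /= eq_sym => /negbTE->; rewrite scale0r.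
  rewrite scaler0 big1 // => k _; case: eqP => [mk|_]; last by rewrite scale0r.
  by have := ltn_ord k; rewrite -mk ltnS (negbTE mi).
(* No aliasing: the exponents stay below [h], so [h] divides only the zero exponent. *)
have dvd0 k : (k + m < h)%N -> (h %| k + m)%N = (k + m == 0)%N.
  move=> kmh; apply/idP/eqP => [hkm|->//].
  by apply/eqP; rewrite -leqn0 leqNgt; apply: contraL hkm => km; rewrite gtnNdvd.
have -> : \sum_(j < h) (z ^+ j) ^+ m *: (geomx ((z ^+ j)^-1 *: T) i) ^t* =
    (if m == 0%N then h%:R else 0) *: 1.
  under eq_bigr do rewrite /geomx adjmx_sum scaler_sumr.
  rewrite exchange_big /=.
  transitivity (\sum_(k < i.+1) (if (k + m == 0)%N then h%:R else 0) *: (T ^t*) ^+ k).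
    apply: eq_bigr => k _; have := ltn_ord k => ki.
    rewrite -dvd0; last lia.
    rewrite -(sum_prim_root _ zh) scaler_suml.
    by apply: eq_bigr => j _; rewrite adjmxX adjmxZ zjV exprZn scalerA -exprD addnC.
  rewrite big_ord_recl add0n expr0 big1 ?addr0 // => k _.
  by rewrite /= scale0r.
have -> : \sum_(j < h) (z ^+ j) ^+ m *: (- (1 : 'M[C]_n.+1)) =
    - ((if m == 0%N then h%:R else 0) *: 1).
  rewrite -scaler_suml (sum_prim_root _ zh) scalerN; congr (- (_ *: _)).
  by rewrite -[m]/(0 + m)%N dvd0 //; lia.
by rewrite addrK.
Qed.

Lemma horner_mxE T (p : {poly C}) :
  horner_mx T p = \sum_(m < size p) p`_m *: T ^+ m.
Proof.
rewrite -{1}[p]coefK poly_def rmorph_sum; apply: eq_bigr => m _ /=.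
by rewrite linearZ /= rmorphXn /= horner_mx_X.
Qed.

(* The left-hand matrix is the sum of the first [size p + L] partial sums of
   [p(T)], the last [L] of which are [p(T)] itself. *)
Lemma horner_mx_mean_le (T : 'M[C]_n.+1) (p : {poly C}) (M : C) :
  (forall x, sqnorm (T *m x) <= sqnorm x) ->
  (forall w, `|w| = 1 -> `|p.[w]| <= M) ->
  exists E : 'M[C]_n.+1, forall L x y,
    2 * `|sesqui (E + L%:R *: horner_mx T p) y x| <=
      M * ((size p + L)%:R * (sqnorm x + sqnorm y)).
Proof.
move=> T1 pM.
pose t i : 'M[C]_n.+1 := \sum_(m < size p) p`_m *: (if (m <= i)%N then T ^+ m else 0).
(* The truncated partial sums are collected in a matrix independent of [L], which becomes negligible
   as [L] grows. *)
exists (\sum_(i < size p) t i) => L x y.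
have [p0|p0] := posnP (size p + L).
  move/eqP: (p0); rewrite addn_eq0 p0 => /andP[/eqP -> /eqP ->].
  by rewrite big_ord0 scale0r addr0 /sesqui mulmx0 mul0mx mxE normr0 mul0r !mulr0.
(* This many roots ensures [m + N <= h] for every index [m < size p]. *)
set N := (size p + L)%N in p0 *; pose h := (size p + N)%N.
have h0 : (0 < h)%N by rewrite /h; lia.
have [z zh] := prim_root_exists C h0.
pose K j := fejermx ((z ^+ j)^-1 *: T) N.
have nz j : `|z ^+ j| = 1 by rewrite normrX (norm_prim_root zh) expr1n.
have KP j : psd (K j).
  apply: psd_fejermx => v; rewrite -scalemxAl sqnormZ normfV nz invr1 expr1n mul1r.
  exact: T1.
have sumK : \sum_(j < h) K j = (h * N)%:R *: 1.
  have := sum_prim_root_fejermx T zh (leq_addl _ _ : (0 + N <= h)%N) p0.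
  under eq_bigr do rewrite expr0 scale1r.
  move=> ->; rewrite /= sumr_const card_ord expr0 natrM -scalerA.
  by congr (_ *: _); rewrite scaler_nat.
have sumpK : \sum_(j < h) p.[z ^+ j] *: K j =
    h%:R *: (\sum_(i < size p) t i + L%:R *: horner_mx T p).
  transitivity (h%:R *: \sum_(i < N) t i).
    under eq_bigr do rewrite horner_coef scaler_suml.
    rewrite exchange_big [\sum_(i < N) t i]exchange_big scaler_sumr /=.
    apply: eq_bigr => m _; rewrite -scaler_sumr scalerA mulrC -scalerA.
    rewrite -(sum_prim_root_fejermx T zh) // ?leq_add2r 1?ltnW // scaler_sumr.
    by apply: eq_bigr => j _; rewrite scalerA.
  congr (_ *: _); rewrite /N big_split_ord /=; congr (_ + _).
  rewrite scaler_nat -[X in _ *+ X]card_ord -sumr_const; apply: eq_bigr => i _.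
  rewrite horner_mxE; apply: eq_bigr => m _; rewrite ifT //.
  by rewrite (leq_trans (ltnW (ltn_ord m))) // leq_addr.
have hC : 0 < h%:R :> C by rewrite ltr0n.
rewrite -(ler_pM2l hC) mulrCA -[X in _ * (X * _)]normr_nat -normrM -sesquiZ -sumpK.
rewrite sesqui_sum.
(* Each kernel is positive and is weighted by a value of [p] of modulus at most [M]; the kernels sum
   to [h * N] times the identity. *)
apply: (@le_trans _ _ (\sum_(j < h) M * (sesqui (K j) x x + sesqui (K j) y y))).
  apply: le_trans (_ : 2 * \sum_(j < h) `|sesqui (p.[z ^+ j] *: K j) y x| <= _).
    by rewrite ler_pM2l ?ltr0n // ler_norm_sum.
  rewrite mulr_sumr ler_sum // => j _; rewrite sesquiZ normrM mulrCA.
  apply: ler_pM => //; [by rewrite mulr_ge0| exact/pM/nz | exact: psd_le_mean].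
rewrite -mulr_sumr big_split /= -!sesqui_sum sumK !sesquiZ !sesqui1 -mulrDr.
by rewrite natrM le_eqVlt; apply/orP; left; apply/eqP; ring.
Qed.

End VonNeumann.

Local Open Scope complex_scope.

(** * The spectral norm and von Neumann's inequality over [R[i]] *)

Section ComplexNorms.
Variable R : realType.
Implicit Types (z w : R[i]).

Lemma sqr_normcE z : Normc.normc z ^+ 2 = complex.Re z ^+ 2 + complex.Im z ^+ 2.
Proof. by case: z => a b /=; rewrite sqr_sqrtr // addr_ge0 ?sqr_ge0. Qed.

Lemma normc_ge0 z : 0 <= Normc.normc z.
Proof. by case: z => a b; exact: sqrtr_ge0. Qed.

Lemma normc_real (a : R) : 0 <= a -> Normc.normc a%:C = a.
Proof. by move=> a0; rewrite /= expr0n addr0 sqrtr_sqr ger0_norm. Qed.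

Lemma Re_le_normc z : complex.Re z <= Normc.normc z.
Proof.
apply: le_trans (ler_norm _) _; rewrite -(@ler_pXn2r _ 2) ?nnegrE ?normc_ge0 //.
by rewrite real_normK ?num_real // sqr_normcE lerDl sqr_ge0.
Qed.

Lemma sqnorm_norm2 n (x : 'cV[R[i]]_n.+1) : sqnorm x = (norm2 x ^+ 2)%:C.
Proof.
rewrite sqnormE /norm2 sqr_sqrtr; last by rewrite sumr_ge0 // => i _; rewrite sqr_ge0.
by rewrite rmorph_sum; apply: eq_bigr => i _; rewrite /= rmorphXn.
Qed.

Lemma norm2_ge0 n (x : 'cV[R[i]]_n) : 0 <= norm2 x.
Proof. exact: sqrtr_ge0. Qed.

Lemma norm2Z n c (x : 'cV[R[i]]_n) : norm2 (c *: x) = Normc.normc c * norm2 x.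
Proof.
rewrite /norm2 -[Normc.normc c]ger0_norm ?normc_ge0 // -sqrtr_sqr -sqrtrM ?sqr_ge0 //.
congr Num.sqrt; rewrite mulr_sumr; apply: eq_bigr => i _.
by rewrite mxE Normc.normcM exprMn.
Qed.

Lemma norm20 n : norm2 (0 : 'cV[R[i]]_n) = 0.
Proof. by rewrite -(scale0r 0) norm2Z Normc.normc0 mul0r. Qed.

Lemma norm2_eq0 n (x : 'cV[R[i]]_n) : norm2 x = 0 -> x = 0.
Proof.
move/eqP; rewrite sqrtr_eq0 => x0; apply/colP => i; rewrite mxE.
apply: Normc.eq0_normc; apply/eqP; rewrite -sqrf_eq0.
have s0 : \sum_(i < n) Normc.normc (x i 0) ^+ 2 == 0.
  by rewrite eq_le x0 sumr_ge0 // => j _; rewrite sqr_ge0.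
rewrite psumr_eq0 in s0; last by move=> j _; rewrite sqr_ge0.
by have /allP/(_ i (mem_index_enum _)) := s0.
Qed.

Lemma normc_le_norm2 n (x : 'cV[R[i]]_n) i : Normc.normc (x i 0) <= norm2 x.
Proof.
rewrite -(@ler_pXn2r _ 2) ?nnegrE ?normc_ge0 ?norm2_ge0 //.
rewrite sqr_sqrtr; last by rewrite sumr_ge0 // => j _; rewrite sqr_ge0.
by rewrite (bigD1 i) //= lerDl sumr_ge0 // => j _; rewrite sqr_ge0.
Qed.

Lemma normc_sum (I : finType) (F : I -> R[i]) :
  Normc.normc (\sum_i F i) <= \sum_i Normc.normc (F i).
Proof.
elim/big_ind2: _ => //; first by rewrite Normc.normc0.
by move=> a b c d ab cd; apply: le_trans (le_normcD _ _) (lerD ab cd).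
Qed.

(** On the unit ball every entry of [x] has modulus at most [1], so each entry of [A *m x] is
    bounded by an absolute row sum of [A]. *)
Lemma has_sup_opnorm2 m n (A : 'M[R[i]]_(m, n)) :
  has_sup [set norm2 (A *m x) | x in [set x : 'cV[R[i]]_n | norm2 x <= 1]]%classic.
Proof.
split; first by exists (norm2 (A *m 0)), 0 => //=; rewrite norm20 ler01.
exists (Num.sqrt (\sum_i (\sum_j Normc.normc (A i j)) ^+ 2)) => _ [x /= x1 <-].
rewrite ler_wsqrtr // ler_sum // => i _.
rewrite ler_pXn2r ?nnegrE ?normc_ge0 ?sumr_ge0 // => [|j _]; last exact: normc_ge0.
rewrite mxE; apply: le_trans (normc_sum _) _; apply: ler_sum => j _.
rewrite Normc.normcM ler_piMr ?normc_ge0 //.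
exact: le_trans (normc_le_norm2 _ _) x1.
Qed.

Lemma norm2_mulmx_le m n (A : 'M[R[i]]_(m, n)) (x : 'cV[R[i]]_n) :
  norm2 (A *m x) <= opnorm2 A * norm2 x.
Proof.
have [/norm2_eq0 ->|x0] := eqVneq (norm2 x) 0.
  by rewrite mulmx0 !norm20 mulr0.
have xp : 0 < norm2 x by rewrite lt_neqAle eq_sym x0 norm2_ge0.
have nV : Normc.normc ((norm2 x)^-1)%:C = (norm2 x)^-1.
  by rewrite normc_real // invr_ge0 norm2_ge0.
rewrite -ler_pdivrMr // mulrC -[X in X * _]nV -norm2Z scalemxAr.
apply: (sup_upper_bound (has_sup_opnorm2 A)).
by exists (((norm2 x)^-1)%:C *: x) => //=; rewrite norm2Z nV mulVf.
Qed.

Lemma opnorm2_ge0 m n (A : 'M[R[i]]_(m, n)) : 0 <= opnorm2 A.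
Proof.
apply: (sup_upper_bound (has_sup_opnorm2 A)).
by exists 0; rewrite /= ?mulmx0 norm20 ?ler01.
Qed.

Lemma opnorm2_le m n (A : 'M[R[i]]_(m, n)) (M : R) :
  0 <= M -> (forall x, norm2 (A *m x) <= M * norm2 x) -> opnorm2 A <= M.
Proof.
move=> M0 AM; apply: ge_sup; first by case: (has_sup_opnorm2 A).
by move=> _ [x /= x1 <-]; apply: le_trans (AM x) _; rewrite ler_piMr.
Qed.

(** The Archimedean property replaces a passage to the limit in the averaging length. *)
Lemma natmul_bounded_le0 (c B : R) : (forall L, L%:R * c <= B) -> c <= 0.
Proof.
move=> cB; rewrite leNgt; apply/negP => c0.
have := cB (Num.bound `|B / c|); apply/negP; rewrite -ltNge -ltr_pdivrMr //.
exact: le_lt_trans (ler_norm _) (archi_boundP (normr_ge0 _)).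
Qed.

Lemma von_neumann n (T : 'M[R[i]]_n.+1) (p : {poly R[i]}) (M : R) :
  0 < M ->
  (forall x, norm2 (T *m x) <= norm2 x) ->
  (forall w, Normc.normc w = 1 -> Normc.normc p.[w] <= M) ->
  forall x, norm2 (horner_mx T p *m x) <= M * norm2 x.
Proof.
move=> M0 T1 pM x.
have sT v : sqnorm (T *m v) <= sqnorm v.
  by rewrite !sqnorm_norm2 lecR ler_pXn2r ?nnegrE ?norm2_ge0.
have pMC w : `|w| = 1 -> `|p.[w]| <= M%:C.
  by move=> [w1]; rewrite lecR pM.
have [E HE] := horner_mx_mean_le sT pMC.
have key y : 2 * Normc.normc (sesqui (horner_mx T p) y x) <=
    M * (norm2 x ^+ 2 + norm2 y ^+ 2).
  rewrite -subr_le0; set c := _ - _.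
  set e := sesqui E y x; set s := norm2 x ^+ 2 + norm2 y ^+ 2.
  (* The bound gathers what does not grow with [L]: the share of the [size p] truncated sums on the
     right, and twice the modulus of the fixed error [e]. *)
  apply: (@natmul_bounded_le0 _ (M * ((size p)%:R * s) + 2 * Normc.normc e)) => L.
  have := HE L x y; rewrite !sqnorm_norm2 sesquiD sesquiZ -rmorphD /= -/s -/e.
  set a := sesqui _ y x.
  have -> : (2 : R[i]) = 2%:C by rewrite rmorph_nat.
  have -> : ((size p + L)%:R : R[i]) = ((size p + L)%:R)%:C by rewrite rmorph_nat.
  rewrite -[`|_|]/((Normc.normc _)%:C) -!rmorphM /= lecR => h.
  have h2 : L%:R * Normc.normc a <= Normc.normc (e + L%:R * a) + Normc.normc e.
    have -> : L%:R * Normc.normc a = Normc.normc (e + L%:R * a - e).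
      by rewrite [in RHS]addrC addKr [in RHS]mulr_natl normcMn mulr_natl.
    by apply: le_trans (le_normcD _ _) _; rewrite normcN.
  rewrite /c -/a -/s; move: h h2; rewrite natrD; nra.
(* The choice [y = u / M] is optimal. *)
set u := horner_mx T p *m x in key *.
have := key ((M^-1)%:C *: u).
rewrite sesqui_mulr -/u sesquiZl sesqui1 sqnorm_norm2 norm2Z Normc.normcM.
have -> : (((M^-1)%:C : R[i])^*)%R = (M^-1)%:C by exact: conjc_real.
rewrite !normc_real ?sqr_ge0 ?invr_ge0 ?(ltW M0) // => h.
rewrite -(@ler_pXn2r _ 2) ?nnegrE ?mulr_ge0 ?norm2_ge0 ?(ltW M0) //.
(* After multiplication by [M] the bound reads [2 |u|^2 <= (M |x|)^2 + |u|^2]. *)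
have : M * (2 * (M^-1 * norm2 u ^+ 2)) <= M * (M * (norm2 x ^+ 2 + (M^-1 * norm2 u) ^+ 2)).
  by rewrite ler_pM2l.
have -> : M * (2 * (M^-1 * norm2 u ^+ 2)) = 2 * norm2 u ^+ 2 by field; rewrite gt_eqF.
have -> : M * (M * (norm2 x ^+ 2 + (M^-1 * norm2 u) ^+ 2)) =
    (M * norm2 x) ^+ 2 + norm2 u ^+ 2 by field; rewrite gt_eqF.
lra.
Qed.

End ComplexNorms.

(** * The scalar inequality for stable polynomials *)

Section ScalarBound.
Variable R : realType.
Implicit Types (p : {poly R[i]}) (w z : R[i]).

(** Roots are nonzero as [p.[0] = 1], and the imaginary part of [- a^-1] is that of [a] divided by
    [|a|^2], hence has the same sign. *)
Lemma stable_factor p : p.[0] = 1 -> stable (@upper_half_plane R) p ->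
  exists2 s : seq R[i], all (fun w => complex.Im w <= 0) s &
    p = \prod_(w <- s) (1 + w *: 'X).
Proof.
move=> p0 pst; have [r pE] := closed_field_poly_normal p.
have lc0 : lead_coef p != 0.
  by rewrite lead_coef_eq0; apply/eqP => h; move/eqP: p0; rewrite h horner0 eq_sym oner_eq0.
have rootr a : a \in r -> root p a.
  by move=> ar; rewrite pE rootZ // root_prod_XsubC.
have r0 a : a \in r -> a != 0.
  move=> /rootr; apply: contraTneq => ->.
  by rewrite /root p0 oner_eq0.
exists [seq - a^-1 | a <- r].
  apply/allP => _ /mapP[a ar ->].
  have : complex.Im a <= 0.
    by rewrite leNgt; apply/negP => /pst; rewrite rootr.
  case: a {ar} => a b /= b0; rewrite opprK.
  by rewrite mulr_le0_ge0 // invr_ge0 addr_ge0 ?sqr_ge0.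
rewrite big_map.
have E : \prod_(a <- r) ('X - a%:P) =
    (\prod_(a <- r) - a) *: \prod_(a <- r) (1 + (- a^-1) *: 'X).
  rewrite -mul_polyC rmorph_prod -big_split; apply: eq_big_seq => a ar /=.
  rewrite mulrDr mulr1 -mul_polyC mulrA -rmorphM mulrNN divff ?r0 // mul1r.
  by rewrite rmorphN addrC.
(* Every factor equals [1] at [0], so evaluation there identifies the constant. *)
rewrite {1}pE E scalerA; set c := _ * _.
suff -> : c = 1 by rewrite scale1r.
move: p0; rewrite {1}pE E scalerA -/c hornerZ horner_prod big1 ?mulr1 // => a _.
by rewrite !hornerE.
Qed.

Lemma sqr_normc_1D w z : Normc.normc (1 + w * z) ^+ 2 <=
  expR (2 * complex.Re (w * z) + Normc.normc w ^+ 2 * Normc.normc z ^+ 2).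
Proof.
apply: le_trans (expR_ge1Dx _); rewrite -exprMn -Normc.normcM !sqr_normcE.
by case: (w * z) => a b /=; rewrite le_eqVlt; apply/orP; left; apply/eqP; ring.
Qed.

Lemma stable_bound_sqr p : p.[0] = 1 -> stable (@upper_half_plane R) p ->
  forall z, Normc.normc p.[z] ^+ 2 <= expR (2 * complex.Re (p`_1 * z) +
     (Normc.normc p`_1 ^+ 2 - 2 * complex.Re p`_2) * Normc.normc z ^+ 2).
Proof.
move=> p0 /(stable_factor p0)[s sI ->] {p p0}.
set P := \prod_(w <- s) _.
(* Induction on the factors must also carry the constant term and the sign of the imaginary part of
   the linear coefficient, which control the cross term below. *)
suff : [/\ P`_0 = 1, complex.Im P`_1 <= 0 & forall z,
    Normc.normc P.[z] ^+ 2 <= expR (2 * complex.Re (P`_1 * z) +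
     (Normc.normc P`_1 ^+ 2 - 2 * complex.Re P`_2) * Normc.normc z ^+ 2)] by case.
rewrite /P {P}; elim: s sI => [|w s IH] /= => [_|/andP[w0 /IH]].
  have -> : (\prod_(w <- [::]) (1 + w *: 'X) : {poly R[i]}) = 1 by rewrite big_nil.
  have [-> ->] : (1 : {poly R[i]})`_1 = 0 /\ (1 : {poly R[i]})`_2 = 0.
    by rewrite !coef1.
  have Re0 : complex.Re (0 : R[i]) = 0 by [].
  rewrite Normc.normc0 Re0 expr0n mulr0 subrr coef1; split=> // z.
  by rewrite hornerC !mul0r Re0 mulr0 addr0 expR0 Normc.normc1 expr1n.
rewrite big_cons; set P := \prod_(_ <- _) _ => -[P0 P1 PB].
have c0 : ((1 + w *: 'X) * P)`_0 = 1.
  by rewrite mulrDl mul1r coefD -scalerAl coefZ coefXM P0 mulr0 addr0.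
have c1 : ((1 + w *: 'X) * P)`_1 = P`_1 + w.
  by rewrite mulrDl mul1r coefD -scalerAl coefZ coefXM P0 mulr1.
have c2 : ((1 + w *: 'X) * P)`_2 = P`_2 + w * P`_1.
  by rewrite mulrDl mul1r coefD -scalerAl coefZ coefXM.
rewrite c0 c1 c2.
(* The right side exceeds the left by [4 * Im w * Im P_1], a product of two nonpositive factors up
   to the constant. *)
have cross : Normc.normc P`_1 ^+ 2 - 2 * complex.Re P`_2 + Normc.normc w ^+ 2 <=
    Normc.normc (P`_1 + w) ^+ 2 - 2 * complex.Re (P`_2 + w * P`_1).
  rewrite !sqr_normcE; move: w0 P1; case: w {c0 c1 c2} => a b; case: (P`_1) => c d.
  case: (P`_2) => e f /= b0 d0; have : 0 <= b * d by rewrite mulr_le0.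
  nra.
split=> //.
  by move: w0 P1; case: w {c0 c1 c2 cross} => a b; case: (P`_1) => c d /= *; rewrite addrC; lra.
move=> z; rewrite hornerM Normc.normcM exprMn hornerD hornerZ hornerX hornerC.
apply: le_trans (ler_pM (sqr_ge0 _) (sqr_ge0 _) (sqr_normc_1D w z) (PB z)) _.
rewrite -expRD ler_expR.
have -> : complex.Re ((P`_1 + w) * z) = complex.Re (P`_1 * z) + complex.Re (w * z).
  by rewrite mulrDl; case: (_ * z) => ? ?; case: (_ * z).
have := ler_wpM2r (sqr_ge0 (Normc.normc z)) cross.
rewrite mulrDl; lra.
Qed.

(** Replacing the real part by the modulus makes the bound depend on [z] only through its modulus,
    so it is constant on circles, as von Neumann's inequality requires. *)
Lemma stable_bound p z : p.[0] = 1 -> stable (@upper_half_plane R) p ->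
  Normc.normc p.[z] <= expR (Normc.normc p`_1 * Normc.normc z +
     2^-1 * (Normc.normc p`_1 ^+ 2 - 2 * complex.Re p`_2) * Normc.normc z ^+ 2).
Proof.
move=> p0 /(stable_bound_sqr p0)/(_ z) pz.
rewrite -(@ler_pXn2r _ 2) ?nnegrE ?normc_ge0 ?expR_ge0 //.
apply: le_trans pz _; rewrite -expRM_natl ler_expR mulrDr mulr_natl.
have := Re_le_normc (p`_1 * z); rewrite Normc.normcM.
move: (complex.Re _) (Normc.normc _ * _) => a b ab.
rewrite -mulr_natl !mulrA mulfV ?pnatr_eq0 // mul1r lerD2r; lra.
Qed.

End ScalarBound.

(** * Transfer to matrices by rescaling to a contraction *)

Theorem theorem4p14 (R : realType) (p : {poly R[i]}) (n : nat)
    (A : 'M[R[i]]_n.+1)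
    (hp0 : p.[0] = 1)
    (hstable : stable (@upper_half_plane R) p) :
  opnorm2 (horner_mx A p) <=
    expR (Normc.normc p`_1 * opnorm2 A
          + 2^-1 * (Normc.normc p`_1 ^+ 2 - 2 * complex.Re p`_2) * opnorm2 A ^+ 2).
Proof.
set r := opnorm2 A; set M := expR _.
have r0 : 0 <= r := opnorm2_ge0 A.
apply: opnorm2_le => [|x]; first exact: expR_ge0.
have [T TA T1] : exists2 T, A = r%:C *: T & forall x, norm2 (T *m x) <= norm2 x.
  (* Division by [r] fails when [r = 0]; then every column of [A] has norm zero, so [A = 0] and
     [T = 0] serves. *)
  have [r00|r00] := eqVneq r 0.
    exists 0 => [|y]; last by rewrite mul0mx norm20 norm2_ge0.
    rewrite scaler0; apply/trmx_inj/row_matrixP => i; rewrite trmx0 row0 -tr_col.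
    apply/trmx_inj; rewrite trmxK trmx0 colE; apply: norm2_eq0; apply/eqP.
    by rewrite eq_le norm2_ge0 (le_trans (norm2_mulmx_le _ _)) // -/r r00 mul0r.
  exists (r^-1%:C *: A) => [|y].
    by rewrite scalerA -rmorphM /= mulfV // scale1r.
  rewrite -scalemxAl norm2Z normc_real ?invr_ge0 // mulrC ler_pdivrMr; last by rewrite lt_neqAle eq_sym r00.
  by rewrite mulrC norm2_mulmx_le.
(* The scaling moves into the polynomial, whose values on the unit circle are those of [p] on the
   circle of radius [r]. *)
have -> : horner_mx A p = horner_mx T (p \Po (r%:C *: 'X)).
  rewrite comp_polyE rmorph_sum horner_mxE; apply: eq_bigr => m _ /=.
  rewrite linearZ rmorphXn /= linearZ /= horner_mx_X TA exprZn.
  by rewrite scalerA.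
apply: von_neumann => [|//|w w1]; first exact: expR_gt0.
rewrite horner_comp !hornerE; apply: le_trans (stable_bound _ hp0 hstable) _.
by rewrite Normc.normcM w1 mulr1 normc_real.
Qed.
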